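(* Let $b,e,k$ be positive integers with $b\ge \max\{2,e+1,k\}$. For any finite graph $G$, $S(\mathsf{Even}(2b/e)-1,2,1)$ is a smallest $(2b+e,b)$-reducible S-handle in $G$, and $S(2b-k,k,k)$ is a smallest $(2b+1,b)$-reducible S-handle in $G$.
   Context: For positive integers $a,b$, an $(a,b)$-coloring of a graph assigns to each vertex a $b$-element subset of $\{1,\ldots,a\}$ so that adjacent vertices receive disjoint subsets. $\mathsf{Even}(x)$ is the least even integer $\ge x$. A handle of length $n$ in $G$ is a path of length $n$ which is an induced subgraph of $G$ whose vertices of degree 2 in the path have degree 2 in $G$. An S-handle $S(n_1,n_2,n_3)$ in $G$ is a handle (the central path $h_0,\ldots,h_{n_1}$) of length $n_1$ such that its end-vertex $h_0$ has degree 3 in $G$ and is also the end-vertex of two other handles of lengths $n_2$ and $n_3$; the far end-vertices of these two handles are the ports; by convention $n_1\ge n_2\ge n_3$. The S-handle is $(a,b)$-reducible in $G$ if every $(a,b)$-coloring of $G$ minus the interior (degree-2 vertices) of the central path can be extended to an $(a,b)$-coloring of $G$, possibly after modifying the color sets of vertices of the S-handle other than its ports and $h_{n_1}$. S-handles are compared componentwise: $S(n_1,n_2,n_3)$ is smaller than $S(n_1',n_2',n_3')$ if $(n_1,n_2,n_3)\le(n_1',n_2',n_3')$ componentwise and they differ. ''A smallest $(a,b)$-reducible S-handle'' means an S-handle type that is $(a,b)$-reducible whenever it occurs, while no strictly smaller S-handle type (respecting the convention) is $(a,b)$-reducible in general.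
   Formalization: The second part is stated for k ≥ 2, since S(2b−1,1,1) is never (2b+1,b)-reducible; for a central path of length 1 its edge is deleted (otherwise S(1,1,1) is trivially reducible); the three handles of an S-handle are taken internally disjoint. *)

(* Defs.v *)
From HB Require Import structures.
From mathcomp Require Import all_boot all_order all_algebra.
Set Implicit Arguments.
Unset Strict Implicit.
Unset Printing Implicit Defensive.
Import Order.TTheory GRing.Theory Num.Theory.

Record sgraph := SGraph {
  vertex :> finType;
  adj : rel vertex;
  adj_sym : symmetric adj;
  adj_irrefl : irreflexive adj }.

Definition degree (G : sgraph) (v : G) : nat := #|[set w | adj v w]|.

(* [coloring_on a b V E c]: the restriction of c to V is an (a,b)-coloring of
   the graph with vertex set V and edge relation E; values of c outside V are
   irrelevant. *)
Definition coloring_on (a b : nat) (T : finType) (V : {set T}) (E : rel T)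
    (c : T -> {set 'I_a}) : Prop :=
  (forall v, v \in V -> #|c v| = b) /\
  (forall u v, u \in V -> v \in V -> E u v -> [disjoint c u & c v]).

Definition coloring (a b : nat) (G : sgraph) (c : G -> {set 'I_a}) : Prop :=
  coloring_on b [set: G] (@adj G) c.

Definition consecutive (i j : nat) : bool := (i.+1 == j) || (j.+1 == i).

Definition interior (G : sgraph) (n : nat) (h : 'I_n.+1 -> G) : {set G} :=
  [set h i | i : 'I_n.+1 & 0 < i < n].

(* The path is h 0, ..., h n; it is an induced subgraph of G because adjacency
   in G between its vertices is exactly adjacency along the path. *)
Definition handle (G : sgraph) (n : nat) (h : 'I_n.+1 -> G) : Prop :=
  [/\ 0 < n,
      injective h,
      forall i j, adj (h i) (h j) = consecutive i j &
      forall v, v \in interior h -> degree v = 2].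

(* Two handles leave their common end-vertex along different edges and meet
   nowhere else, except that their far end-vertices may coincide. *)
Definition internally_disjoint (G : sgraph) (m n : nat)
    (h : 'I_m.+1 -> G) (h' : 'I_n.+1 -> G) : Prop :=
  h (inord 1) <> h' (inord 1) /\
  (forall i j, h i = h' j ->
     (i = ord0 /\ j = ord0) \/ (i = ord_max /\ j = ord_max)).

(* Handle 1 is the central path. *)
Record S_handle (G : sgraph) (n1 n2 n3 : nat) := SHandle {
  arm1 : 'I_n1.+1 -> G;
  arm2 : 'I_n2.+1 -> G;
  arm3 : 'I_n3.+1 -> G;
  arm1_handle : handle arm1;
  arm2_handle : handle arm2;
  arm3_handle : handle arm3;
  arm2_start : arm2 ord0 = arm1 ord0;
  arm3_start : arm3 ord0 = arm1 ord0;
  start_degree : degree (arm1 ord0) = 3;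
  arms12 : internally_disjoint arm1 arm2;
  arms13 : internally_disjoint arm1 arm3;
  arms23 : internally_disjoint arm2 arm3 }.

Definition S_vertices (G : sgraph) (n1 n2 n3 : nat)
    (S : S_handle G n1 n2 n3) : {set G} :=
  [set arm1 S i | i : 'I_n1.+1] :|: [set arm2 S i | i : 'I_n2.+1]
  :|: [set arm3 S i | i : 'I_n3.+1].

(* The two ports and the far end-vertex of the central path. *)
Definition S_fixed (G : sgraph) (n1 n2 n3 : nat)
    (S : S_handle G n1 n2 n3) : {set G} :=
  [set arm1 S ord_max; arm2 S ord_max; arm3 S ord_max].

(* Edges of G that are not edges of the path h.  When the path has length at
   least 2, each of its edges meets its interior, so that deleting the interior
   already deletes them.  Only for length 1, where there is no interior vertex,
   does this matter: there the single edge of the path is what is removed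
   (otherwise S(1,1,1) would be reducible for trivial reasons). *)
Definition adj_off_path (G : sgraph) (n : nat) (h : 'I_n.+1 -> G) : rel G :=
  fun u v => adj u v &&
    ~~ [exists i : 'I_n.+1, exists j : 'I_n.+1,
         [&& consecutive i j, h i == u & h j == v]].

Definition reducible (a b : nat) (G : sgraph) (n1 n2 n3 : nat)
    (S : S_handle G n1 n2 n3) : Prop :=
  forall c : G -> {set 'I_a},
    coloring_on b (~: interior (arm1 S)) (adj_off_path (arm1 S)) c ->
    exists2 c' : G -> {set 'I_a}, coloring b c' &
      forall v, v \notin S_vertices S :\: S_fixed S -> c' v = c v.

Definition S_type (n1 n2 n3 : nat) : bool := [&& 0 < n3, n3 <= n2 & n2 <= n1].

Definition reducible_type (a b n1 n2 n3 : nat) : Prop :=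
  forall (G : sgraph) (S : S_handle G n1 n2 n3), reducible a b S.

Definition smaller_type (m1 m2 m3 n1 n2 n3 : nat) : bool :=
  [&& m1 <= n1, m2 <= n2, m3 <= n3 & (m1, m2, m3) != (n1, n2, n3)].

Definition smallest_reducible (a b n1 n2 n3 : nat) : Prop :=
  [/\ S_type n1 n2 n3,
      reducible_type a b n1 n2 n3 &
      forall m1 m2 m3, S_type m1 m2 m3 -> smaller_type m1 m2 m3 n1 n2 n3 ->
        ~ reducible_type a b m1 m2 m3].

(* In particular S(2b-1,1,1) and S(2b-1,2,1) cannot both be smallest
   (2b+1,b)-reducible. *)
Lemma smallest_reducible_antichain (a b m1 m2 m3 n1 n2 n3 : nat) :
  smaller_type m1 m2 m3 n1 n2 n3 ->
  smallest_reducible a b m1 m2 m3 -> ~ smallest_reducible a b n1 n2 n3.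
Proof. by move=> lt_mn [mT mR _] [_ _ /(_ _ _ _ mT lt_mn)]. Qed.

Lemma even_ge_exists (x : rat) :
  exists n : nat, ~~ odd n && (x <= n%:R)%R.
Proof.
exists (Num.bound `|x|%R).*2; rewrite odd_double /=.
apply: (@le_trans _ _ (Num.bound `|x|%R)%:R%R).
  by apply: (le_trans (ler_norm x)); apply/ltW/archi_boundP/normr_ge0.
by rewrite ler_nat -addnn leq_addr.
Qed.

(* The least even natural number >= x, which for x >= 0 is the least even
   integer >= x. *)
Definition Even (x : rat) : nat := ex_minn (even_ge_exists x).

(* Main.v *)
Require Import Defs.
From mathcomp Require Import all_boot all_order all_algebra.
From mathcomp Require Import zify.
Set Implicit Arguments.
Unset Strict Implicit.
Unset Printing Implicit Defensive.
Import Order.TTheory GRing.Theory Num.Theory.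

(* With 2b+e colors, the color sets reachable along a path of length n from a
   b-set Y are the b-sets X with |X :&: Y| <= (n/2) e (n odd) or
   |X :\: Y| <= (n/2) e (n even).  Reducibility of an S-handle thus asks for a new
   color set of h_0 subject to three such cardinality constraints, given one that
   satisfies the two constraints of the ports.  Conversely, if (p-1) e < b, no path
   of length less than 2p can repair an alternating coloring whose last set has the
   wrong parity; in a spider this applies to the first and third arms together
   when n1 + n3 < 2p, which covers every smaller type except S(2p-1,1,1).  There the
   two ports can be colored so that the color set of h_0 is forced. *)

(** * Finite sets of prescribed size *)

Lemma subset_sandwich (T : finType) (A B : {set T}) m :
  A \subset B -> #|A| <= m <= #|B| ->
  exists D : {set T}, [/\ A \subset D, D \subset B & #|D| = m].
Proof.
move=> sAB; elim: m => [|m IHm] /andP[leAm lemB].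
  by exists A; split=> //; apply/eqP; rewrite -leqn0.
have [ltAm|leAm'] := ltnP m #|A|.
  by exists A; split=> //; apply/eqP; rewrite eqn_leq leAm.
have [|D [sAD sDB cD]] := IHm; first by rewrite leAm' ltnW.
have /properP[_ [x xB xD]] : D \proper B by rewrite properEcard sDB cD.
exists (x |: D); rewrite cardsU1 xD cD; split=> //.
  exact: subset_trans sAD (subsetUr _ _).
by rewrite subUset sub1set xB.
Qed.

(** Enlarge [D] by elements of [Z :&: C] until it has [q] elements of [C], then by arbitrary
    elements of [Z]. The last inequality says that the [q - #|D :&: C|] missing elements fit into
    the [m - #|D|] free places. *)
Lemma subset_fill (T : finType) (D Z C : {set T}) m q :
  D \subset Z -> #|D| <= m <= #|Z| -> q <= #|Z :&: C| ->
  #|D| + q <= m + #|D :&: C| ->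
  exists X : {set T}, [/\ D \subset X, X \subset Z, #|X| = m & q <= #|X :&: C|].
Proof.
move=> sDZ leDmZ leqZ leDq.
have [D' [sDD' sD'Z leD'm leqD']] : exists D' : {set T},
    [/\ D \subset D', D' \subset Z, #|D'| <= m & q <= #|D' :&: C|].
  have [leqD|ltDq] := leqP q #|D :&: C|.
    by exists D; split=> //; case/andP: leDmZ.
  have [|E [sE1 sE2 cE]] := @subset_sandwich _ (D :&: C) (Z :&: C) q (setSI _ sDZ).
    by rewrite ltnW.
  have [sEZ sEC] : E \subset Z /\ E \subset C by apply/andP; rewrite -subsetI.
  exists (D :|: E); split.
  - exact: subsetUl.
  - by rewrite subUset sDZ.
  - have sub : D :&: C \subset D :&: E by rewrite subsetI subsetIl.
    move/subset_leq_card: sub; have := cardsUI D E; lia.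
  - rewrite -cE; apply: subset_leq_card; rewrite subsetI sEC andbT.
    exact: subsetUr.
have [|X [sD'X sXZ cX]] := @subset_sandwich _ D' Z m sD'Z.
  by rewrite leD'm; case/andP: leDmZ.
exists X; split=> //; first exact: subset_trans sD'X.
exact: leq_trans leqD' (subset_leq_card (setSI _ sD'X)).
Qed.

Lemma subset_maxI (T : finType) (Z C : {set T}) m : m <= #|Z| ->
  exists X : {set T}, [/\ X \subset Z, #|X| = m & minn m #|Z :&: C| <= #|X :&: C|].
Proof.
move=> lemZ.
have [||||X [_ sXZ cX leX]] := @subset_fill _ set0 Z C m (minn m #|Z :&: C|).
- exact: sub0set.
- by rewrite cards0.
- exact: geq_minr.
- by rewrite set0I cards0 addn0 geq_minl.
by exists X.
Qed.

(** * Color sets along a path *)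

Lemma card_setC_coloring (T : finType) (b e : nat) (X : {set T}) :
  #|T| = 2 * b + e -> #|X| = b -> #|~: X| = b + e.
Proof. by move=> cT cX; have := cardsC X; rewrite cT; lia. Qed.

(* With [2b + e] colors, [b]-sets [X] and [Y] are the color sets of the two ends
   of a colored path of length [n] exactly when [compat e n X Y]. *)
Definition compat (T : finType) (e n : nat) (X Y : {set T}) : bool :=
  if odd n then #|X :&: Y| <= n./2 * e else #|X :\: Y| <= n./2 * e.

(** Two steps cost at most [e]: if [Z] follows [Y], then [X :&: Z] lies in [X :\: Y], while
    [X :\: Z] lies in the union of [X :&: Y] and the [e] colors outside [Y :|: Z]. *)
Lemma compat_chain (T : finType) (b e n : nat) (f : nat -> {set T}) :
  #|T| = 2 * b + e -> (forall i, i <= n -> #|f i| = b) ->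
  (forall i, i < n -> [disjoint f i & f i.+1]) ->
  compat e n (f 0) (f n).
Proof.
move=> cT; elim: n => [|n IHn] cf df; first by rewrite /compat setDv cards0.
have {IHn} := IHn (fun i le_i => cf i (leqW le_i)) (fun i lt_i => df i (leqW lt_i)).
have := df n (ltnSn n); have := cf n (leqnSn n); have := cf n.+1 (leqnn _).
have := cf 0 isT; move: (f 0) (f n) (f n.+1) => X Y Z cX cY cZ dYZ.
rewrite /compat /= uphalf_half.
case: (odd n) => /= leXY; last first.
  rewrite add0n; apply: leq_trans leXY; apply: subset_leq_card.
  rewrite subsetD subsetIl /=; rewrite disjoint_sym.
  by apply: disjointWr dYZ; apply: subsetIr.
rewrite mulSn addnC; apply: leq_trans (leq_add leXY (leqnn e)).
have cYZ : #|~: (Y :|: Z)| = e.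
  have := cardsC (Y :|: Z); have := leq_card_setU Y Z.
  by rewrite dYZ /= => -[_ /eqP]; rewrite cT; lia.
rewrite -cYZ; apply: leq_trans (leq_card_setU _ _).1; apply: subset_leq_card.
apply/subsetP => x; rewrite !inE negb_or => /andP[-> ->] /=.
by case: (x \in Y).
Qed.

(** [Z] is chosen greedily in the complement of [X], with as few elements of [Y] as possible for odd
    [n] and as many as possible for even [n]. *)
Lemma compat_step (T : finType) (b e n : nat) (X Y : {set T}) :
  #|T| = 2 * b + e -> #|X| = b -> #|Y| = b -> compat e n.+1 X Y ->
  exists Z : {set T}, [/\ #|Z| = b, [disjoint X & Z] & compat e n Z Y].
Proof.
move=> cT cX cY; rewrite /compat /= uphalf_half.
have cCX := card_setC_coloring cT cX.
have lebCX : b <= #|~: X| by rewrite cCX leq_addr.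
have := cardsID Y X; have := cardsID X Y; rewrite [Y :&: X]setIC => eY eX.
case: (odd n) => /= le.
- have [Z [sZX cZ leZ]] := subset_maxI (~: Y) lebCX.
  exists Z; split=> //; first by rewrite disjoint_sym disjoints_subset.
  have := cardsID Y (~: X); have := cardsID Y Z.
  rewrite [~: X :&: Y]setIC -!setDE in leZ *; move: leZ; rewrite cCX cZ.
  move: le; rewrite mulSn; move: (n./2 * e) => t; lia.
- have [Z [sZX cZ leZ]] := subset_maxI Y lebCX.
  exists Z; split=> //; first by rewrite disjoint_sym disjoints_subset.
  have := cardsID Y Z; move: leZ; rewrite cZ [~: X :&: Y]setIC -setDE; move: le; lia.
Qed.

Lemma compat_path (T : finType) (b e n : nat) (X Y : {set T}) :
  #|T| = 2 * b + e -> #|X| = b -> #|Y| = b -> compat e n X Y ->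
  exists f : nat -> {set T}, [/\ f 0 = X, f n = Y,
    forall i, i <= n -> #|f i| = b & forall i, i < n -> [disjoint f i & f i.+1]].
Proof.
move=> cT; elim: n X => [|n IHn] X cX cY.
  rewrite /compat /= mul0n leqn0 cards_eq0 setD_eq0 => sXY.
  have <- : X = Y by apply/eqP; rewrite eqEcard sXY cX cY /=.
  by exists (fun _ => X).
case/(compat_step cT cX cY) => Z [cZ dXZ /(IHn Z cZ cY)[f [f0 fn cf df]]].
exists (fun i => if i is i'.+1 then f i' else X); split=> //.
  by case=> // i; apply: cf.
by case=> [|i] lt_in; [rewrite f0 | apply: df].
Qed.

(** * New color sets for the center *)

Lemma recolor_2_1 (T : finType) (b e : nat) (A B C X0 : {set T}) :
  #|T| = 2 * b + e -> e <= b ->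
  #|B| = b -> #|C| = b -> #|X0| = b -> [disjoint X0 & B] -> #|X0 :\: A| <= e ->
  exists X : {set T},
    [/\ #|X| = b, [disjoint X & B], #|X :\: A| <= e & #|X :&: C| <= b - e].
Proof.
move=> cT le_eb cB cC cX0 dX0B leX0A.
have sX0 : X0 \subset ~: B by rewrite -disjoints_subset.
have cCB := card_setC_coloring cT cB.
(* Keeping [b - e] old elements inside [A] leaves only [e] elements that may fall outside [A]. *)
have [|D [_ sD cD]] := @subset_sandwich _ set0 (X0 :&: A) (b - e) (sub0set _).
  by rewrite cards0 /=; have := cardsID A X0; lia.
have [sDX0 sDA] : D \subset X0 /\ D \subset A by apply/andP; rewrite -subsetI.
(* The [e] new elements avoid [B], and [C] as far as needed: of the [b + e] colors outside [B], at
   least [e] are outside [C]. *)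
have [||||X [sDX sXB cX leX]] := @subset_fill _ D (~: B) (~: C) b e.
- exact: subset_trans sX0.
- by rewrite cD cCB; lia.
- have := cardsID C (~: B); have := subset_leq_card (subsetIr (~: B) C).
  by rewrite setDE; lia.
- by rewrite cD; lia.
exists X; split=> //; first by rewrite disjoints_subset.
- have := cardsID A X; have : #|D| <= #|X :&: A|.
    by apply: subset_leq_card; rewrite subsetI sDX.
  by lia.
- by have := cardsID C X; move: leX; rewrite setDE; lia.
Qed.

(** In [recolor_three], [d], [p], [q] are the sizes of [A :&: B], [A :\: B], [B :\: A], and [x],
    [y], [z] those of their traces on [C]. *)
Lemma three_targets_arith b j s d p q x y z :
  0 < j -> s <= 1 -> 2 * j + s <= b -> b <= d + 2 * j ->
  d + p = b + s -> d + q = b + s -> x <= d -> y <= p -> z <= q ->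
  s <= x + y -> s <= x + z -> b + 3 * s <= x + y + z + d + 1 ->
  exists u, [/\ u <= j, b - j - u <= d, u <= p, u <= q &
    u + s <= minn (b - j - u) x + minn u y + minn u z].
Proof.
move=> j0 s1 ljb dge ep eq lx ly lz sxy sxz sxyz.
have [ltd|led] := ltnP d (b - j).
  exists (b - j - d); split; lia.
have [h|h] := leqP s x; first by exists 0; split; lia.
by exists 1; split; lia.
Qed.

(* [X] consists of [b - j - u] elements of [A :&: B] and [u] elements of each of
   [A :\: B] and [B :\: A], all chosen in [C] if possible, completed inside [C];
   [u] is the deficit of [A :&: B], or 1 if [A :&: B] misses [C] and [s = 1]. *)
Lemma recolor_three (T : finType) (b j s : nat) (A B C X0 : {set T}) :
  #|T| = 2 * b + 1 -> 0 < j -> s <= 1 -> 2 * j + s <= b ->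
  #|A| = b + s -> #|B| = b + s -> #|C| = b + s -> #|X0| = b ->
  #|X0 :\: A| <= j -> #|X0 :\: B| <= j ->
  exists X : {set T},
    [/\ #|X| = b, #|X :\: A| <= j, #|X :\: B| <= j & j + s <= #|X :&: C|].
Proof.
move=> cT j0 s1 ljb cA cB cC cX0 lA lB.
(* The old set [X0] has at most [2 * j] elements outside [A :&: B]. *)
have dge : b <= #|A :&: B| + 2 * j.
  have := cardsID (A :&: B) X0; have := subset_leq_card (subsetIr X0 (A :&: B)).
  by have := (leq_card_setU (X0 :\: A) (X0 :\: B)).1; rewrite -setDIr; lia.
have eA := cardsID B A; have := cardsID A B; rewrite [B :&: A]setIC => eB.
have eAC := cardsID B (A :&: C); have eBC := cardsID A (B :&: C).
have eABC : B :&: C :&: A = A :&: B :&: C by rewrite setIC setIA.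
have eABC' : A :&: C :&: B = A :&: B :&: C by rewrite setIAC.
have eDA : A :&: C :\: B = (A :\: B) :&: C by rewrite !setDE setIAC.
have eDB : B :&: C :\: A = (B :\: A) :&: C by rewrite !setDE setIAC.
rewrite eABC eDB in eBC; rewrite eABC' eDA in eAC.
have gAC := cardsUI A C; have gBC := cardsUI B C.
have gAB := cardsUI A B.
have gABC := cardsUI (A :|: B) C.
have mAC := max_card (A :|: C); have mBC := max_card (B :|: C).
have mABC := max_card (A :|: B :|: C).
have eUC : #|(A :|: B) :&: C| = #|A :&: C| + #|(B :\: A) :&: C|.
  rewrite -(cardsID A); congr (_ + _); apply: eq_card => x; rewrite !inE;
    by case: (x \in A); case: (x \in B); case: (x \in C).
have sDA := subset_leq_card (subsetIl (A :\: B) C).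
have sDB := subset_leq_card (subsetIl (B :\: A) C).
have sD := subset_leq_card (subsetIl (A :&: B) C).
(* With [b - j + u] elements chosen, [j - u] places remain for elements of [C]; hence [u + s] of the
   chosen ones must already be in [C]. *)
have [u [u1 u2 u3 u4 u5]] : exists u, [/\ u <= j, b - j - u <= #|A :&: B|,
    u <= #|A :\: B|, u <= #|B :\: A| &
    u + s <= minn (b - j - u) #|A :&: B :&: C| + minn u #|(A :\: B) :&: C|
             + minn u #|(B :\: A) :&: C|].
  (* These three bounds are inclusion-exclusion counts among [2 * b + 1] colors. *)
  have sAC : s <= #|A :&: B :&: C| + #|(A :\: B) :&: C| by lia.
  have sBC : s <= #|A :&: B :&: C| + #|(B :\: A) :&: C| by lia.
  have sABC : b + 3 * s <= #|A :&: B :&: C| + #|(A :\: B) :&: C|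
                          + #|(B :\: A) :&: C| + #|A :&: B| + 1 by lia.
  clear - j0 s1 ljb cA cB dge eA eB sDA sDB sD sAC sBC sABC.
  rewrite cA in eA; rewrite cB in eB; exact: three_targets_arith.
clear - cT s1 ljb cC u1 u2 u3 u4 u5.
have [D [sDAB cD lD]] := subset_maxI C u2.
have [E [sE cE lE]] := subset_maxI C u3.
have [F [sF cF lF]] := subset_maxI C u4.
have {lD lE lF u2 u3 u4 u5} lU :
    u + s <= #|D :&: C| + #|E :&: C| + #|F :&: C| by clear - lD lE lF u5; lia.
move: sDAB sE sF; rewrite subsetI !subsetD => /andP[DA DB] /andP[EA EB] /andP[FB FA].
have dDE : [disjoint D & E] by apply: disjointWl DB _; rewrite disjoint_sym.
have dDF : [disjoint D & F] by apply: disjointWl DA _; rewrite disjoint_sym.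
have dEF : [disjoint E & F] by apply: disjointWl EA _; rewrite disjoint_sym.
have cardsU_disj (P Q : {set T}) : [disjoint P & Q] -> #|P :|: Q| = #|P| + #|Q|.
  by move=> dPQ; have [_] := leq_card_setU P Q; rewrite dPQ => /eqP.
have dU : [disjoint D :|: E & F] by rewrite disjoints_subset subUset -!disjoints_subset dDF.
have cU : #|D :|: E :|: F| = b - j + u.
  by rewrite !cardsU_disj // cD cE cF; clear - u1 ljb; lia.
have cUC : #|(D :|: E :|: F) :&: C| = #|D :&: C| + #|E :&: C| + #|F :&: C|.
  rewrite !setIUl !cardsU_disj //.
    by apply: disjointW dDE; apply: subsetIl.
  by rewrite -setIUl; apply: disjointW dU; apply: subsetIl.
have [||||X [sX _ cX lX]] := @subset_fill _ (D :|: E :|: F) setT C b (j + s).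
- exact: subsetT.
- by rewrite cU cardsT cT; clear - u1 ljb; lia.
- by rewrite setTI cC; clear - ljb; lia.
- by rewrite cU cUC; clear - lU u1 ljb; lia.
exists X; split=> //.
- have := cardsID A X; have : #|D :|: E| <= #|X :&: A|.
    apply: subset_leq_card.
    by rewrite subsetI (subset_trans (subsetUl _ _) sX) subUset DA.
  by rewrite cardsU_disj // cD cE cX; clear - u1 ljb; lia.
- have := cardsID B X; have : #|D :|: F| <= #|X :&: B|.
    apply: subset_leq_card.
    by rewrite setUAC in sX; rewrite subsetI (subset_trans (subsetUl _ _) sX) subUset DB.
  by rewrite cardsU_disj // cD cF cX; clear - u1 ljb; lia.
Qed.

(** * Handles and the arms of an S-handle *)

Lemma degree2_adj (G : sgraph) (v x y w : G) :
  degree v = 2 -> adj v x -> adj v y -> x != y -> adj v w -> w = x \/ w = y.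
Proof.
move=> dv vx vy xy vw.
have /eqP eN : [set x; y] == [set w | adj v w].
  rewrite eqEcard -/(degree v) dv cards2 xy leqnn andbT.
  by apply/subsetP => z; rewrite !inE => /orP[]/eqP->.
have : w \in [set x; y] by rewrite eN inE.
by rewrite !inE => /orP[]/eqP; [left | right].
Qed.

Lemma handle_adj (G : sgraph) n (h : 'I_n.+1 -> G) i :
  handle h -> i < n -> adj (h (inord i)) (h (inord i.+1)).
Proof. by case=> _ _ -> _ lt_in; rewrite /consecutive !inordK ?eqxx // ltnW. Qed.

Lemma handle_inj (G : sgraph) n (h : 'I_n.+1 -> G) i j :
  handle h -> i <= n -> j <= n -> h (inord i) = h (inord j) -> i = j.
Proof.
case=> _ inj_h _ _ le_in le_jn /inj_h /(congr1 val) /=.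
by rewrite !inordK.
Qed.

Lemma handle_interior_adj (G : sgraph) n (h : 'I_n.+1 -> G) i w :
  handle h -> 0 < i < n -> adj (h (inord i)) w ->
  w = h (inord i.-1) \/ w = h (inord i.+1).
Proof.
move=> hh /andP[i0 lt_in]; apply: degree2_adj.
- case: hh => _ _ _; apply; apply/imsetP; exists (inord i) => //.
  by rewrite inE inordK ?i0 // ltnW.
- by rewrite adj_sym -{2}(prednK i0); apply: handle_adj => //; lia.
- exact: handle_adj.
- by apply/eqP => /(handle_inj hh); lia.
Qed.

Lemma internally_disjoint_inord (G : sgraph) m n
    (h : 'I_m.+1 -> G) (h' : 'I_n.+1 -> G) i j :
  internally_disjoint h h' -> i <= m -> j <= n -> h (inord i) = h' (inord j) ->
  (i = 0 /\ j = 0) \/ (i = m /\ j = n).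
Proof.
case=> _ hd le_im le_jn /hd[][/(congr1 val) /= ei /(congr1 val) /= ej]; move: ei ej;
  rewrite !inordK // => -> ->; by [left | right].
Qed.

(** Indexing the arms by the three-element type [option bool], with [None] for the central path,
    lets facts about all arms be stated once. *)
Definition arm_length (n1 n2 n3 : nat) (k : option bool) : nat :=
  match k with None => n1 | Some true => n2 | Some false => n3 end.

Definition arm (G : sgraph) n1 n2 n3 (S : S_handle G n1 n2 n3)
    (k : option bool) (i : nat) : G :=
  match k with
  | None => arm1 S (inord i)
  | Some true => arm2 S (inord i)
  | Some false => arm3 S (inord i)
  end.

Lemma inord0 n : inord 0 = ord0 :> 'I_n.+1.
Proof. by apply: val_inj; rewrite /= inordK. Qed.

Lemma inord_max n : inord n = ord_max :> 'I_n.+1.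
Proof. by apply: val_inj; rewrite /= inordK. Qed.

Section ArmFacts.

Context (G : sgraph) (n1 n2 n3 : nat) (S : S_handle G n1 n2 n3).
Local Notation len := (arm_length n1 n2 n3).

Lemma arm_length_gt0 k : 0 < len k.
Proof.
by case: k => [[]|] /=; [case: (arm2_handle S)|case: (arm3_handle S)|case: (arm1_handle S)].
Qed.

Lemma arm_start k : arm S k 0 = arm1 S ord0.
Proof. by case: k => [[]|] /=; rewrite inord0 // (arm2_start, arm3_start). Qed.

Lemma arm_adj k i : i < len k -> adj (arm S k i) (arm S k i.+1).
Proof.
by case: k => [[]|] /=; apply: handle_adj;
  [apply: arm2_handle | apply: arm3_handle | apply: arm1_handle].
Qed.

Lemma arm_interior_adj k i w : 0 < i < len k -> adj (arm S k i) w ->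
  w = arm S k i.-1 \/ w = arm S k i.+1.
Proof.
by case: k => [[]|] /=; apply: handle_interior_adj;
  [apply: arm2_handle | apply: arm3_handle | apply: arm1_handle].
Qed.

(** The third alternative can occur, since far ends of different arms may coincide. *)
Lemma arm_eq k l i j : i <= len k -> j <= len l -> arm S k i = arm S l j ->
  [\/ k = l /\ i = j, i = 0 /\ j = 0 | [/\ k <> l, i = len k & j = len l]].
Proof.
case: k l => [[]|] [[]|] /= li lj E.
- by constructor 1; split=> //; apply: handle_inj E => //; apply: arm2_handle.
- by case: (internally_disjoint_inord (arms23 S) li lj E) => -[]; [constructor 2|constructor 3].
- by case: (internally_disjoint_inord (arms12 S) lj li (esym E)) => -[]; [constructor 2|constructor 3].
- by case: (internally_disjoint_inord (arms23 S) lj li (esym E)) => -[]; [constructor 2|constructor 3].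
- by constructor 1; split=> //; apply: handle_inj E => //; apply: arm3_handle.
- by case: (internally_disjoint_inord (arms13 S) lj li (esym E)) => -[]; [constructor 2|constructor 3].
- by case: (internally_disjoint_inord (arms12 S) li lj E) => -[]; [constructor 2|constructor 3].
- by case: (internally_disjoint_inord (arms13 S) li lj E) => -[]; [constructor 2|constructor 3].
- by constructor 1; split=> //; apply: handle_inj E => //; apply: arm1_handle.
Qed.

Lemma arm_first_neq k l : k != l -> arm S k 1 != arm S l 1.
Proof.
move=> kl; apply/eqP; move: kl.
case: k l => [[]|] [[]|] //= _.
- by case: (arms23 S).
- by move/esym; case: (arms12 S).
- by move/esym; case: (arms23 S).
- by move/esym; case: (arms13 S).
- by case: (arms12 S).
- by case: (arms13 S).
Qed.

(** The first vertices of the arms are three distinct neighbors of a vertex of degree 3. *)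
Lemma arm_start_adj w : adj (arm1 S ord0) w -> exists k, w = arm S k 1.
Proof.
have inj_first : injective (fun k => arm S k 1).
  by move=> k l; apply: contra_eq; apply: arm_first_neq.
have /eqP eN : [set arm S k 1 | k : option bool] == [set w | adj (arm1 S ord0) w].
  rewrite eqEcard -/(degree (arm1 S ord0)) start_degree card_imset //.
  rewrite card_option card_bool andbT.
  apply/subsetP => _ /imsetP[k _ ->]; rewrite inE -(arm_start k).
  exact: arm_adj (arm_length_gt0 k).
move=> ww; have : w \in [set arm S k 1 | k : option bool] by rewrite eN inE.
by case/imsetP => k _ ->; exists k.
Qed.

Lemma arm_interior1 v :
  reflect (exists2 i, 0 < i < n1 & v = arm S None i) (v \in interior (arm1 S)).
Proof.
apply: (iffP imsetP) => [[i]|[i lt_i ->]].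
  by rewrite inE => lt_i ->; exists i; rewrite //= inord_val.
by exists (inord i) => //; rewrite inE inordK //; lia.
Qed.

Lemma mem_S_vertices v :
  reflect (exists k, exists2 i, i <= len k & v = arm S k i) (v \in S_vertices S).
Proof.
apply: (iffP idP) => [|[k [i li ->]]].
  rewrite !inE => /orP[/orP[]|] /imsetP[i _ ->]; have := ltn_ord i; rewrite ltnS => li.
  - by exists None, i; rewrite //= inord_val.
  - by exists (Some true), i; rewrite //= inord_val.
  - by exists (Some false), i; rewrite //= inord_val.
by rewrite !inE; case: k li => [[]|] /= li; rewrite imset_f ?orbT.
Qed.

Lemma arm_end_fixed k : arm S k (len k) \in S_fixed S.
Proof. by case: k => [[]|] /=; rewrite inord_max !inE eqxx ?orbT. Qed.

Lemma mem_S_fixed v : v \in S_fixed S -> exists k, v = arm S k (len k).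
Proof.
rewrite !inE => /orP[/orP[]|] /eqP->.
- by exists None; rewrite /= inord_max.
- by exists (Some true); rewrite /= inord_max.
- by exists (Some false); rewrite /= inord_max.
Qed.

(** An edge shared with the central path would have to join the center to a common far end, both
    arms having length 1; but the arms leave the center along different edges. *)
Lemma arm_off_path k i : k != None -> i < len k ->
  adj_off_path (arm1 S) (arm S k i) (arm S k i.+1).
Proof.
move=> kN lik; rewrite /adj_off_path arm_adj //=.
apply/negP => /existsP[x /existsP[y /and3P[cxy /eqP ex /eqP ey]]].
have kN' := elimN eqP kN.
have xE : arm S None x = arm S k i by rewrite /= inord_val.
have yE : arm S None y = arm S k i.+1 by rewrite /= inord_val.
have := ltn_ord x; have := ltn_ord y; rewrite !ltnS => ly lx.
case: (arm_eq (k := None) (l := k) lx (ltnW lik) xE) => [[/esym]|[x0 i0]|[_ _]] //; last lia.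
case: (arm_eq (k := None) (l := k) ly lik yE) => [[/esym]|[]|[_ y1 i1]] //.
have y_1 : nat_of_ord y = 1 by move: cxy; rewrite /consecutive; lia.
have /eqP := arm_first_neq kN; apply.
by rewrite -i0 -yE y_1 i0.
Qed.

Lemma arm_notin_interior k i : k != None -> i <= len k ->
  arm S k i \notin interior (arm1 S).
Proof.
move=> /eqP kN li; apply/arm_interior1 => -[j lj].
have lj' : j <= len None by rewrite /=; lia.
by case/(arm_eq li lj') => [[]|[_]|[_ _ /=]]; [|lia|lia].
Qed.

Lemma arm_chain_off b a (c : G -> {set 'I_a}) k :
  coloring_on b (~: interior (arm1 S)) (adj_off_path (arm1 S)) c -> k != None ->
  (forall i, i <= len k -> #|c (arm S k i)| = b) /\
  (forall i, i < len k -> [disjoint c (arm S k i) & c (arm S k i.+1)]).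
Proof.
case=> cc dc kN; split=> i li.
  by apply: cc; rewrite inE arm_notin_interior.
by apply: dc; rewrite ?inE ?arm_notin_interior ?arm_off_path // ltnW.
Qed.

Lemma recolor_arms a b (c : G -> {set 'I_a}) (X : {set 'I_a})
    (f : option bool -> nat -> {set 'I_a}) :
  coloring_on b (~: interior (arm1 S)) (adj_off_path (arm1 S)) c ->
  (forall k, f k 0 = X) ->
  (forall k, f k (len k) = c (arm S k (len k))) ->
  (forall k i, i <= len k -> #|f k i| = b) ->
  (forall k i, i < len k -> [disjoint f k i & f k i.+1]) ->
  exists2 c' : G -> {set 'I_a}, coloring b c' &
    forall v, v \notin S_vertices S :\: S_fixed S -> c' v = c v.
Proof.
move=> [cc dc] f0 fe cf df.
pose onarm v (p : {k : option bool & 'I_(len k).+1}) :=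
  arm S (tag p) (tagged p) == v.
(* Any position of [v] may be picked: distinct positions of one vertex are either all at the center,
   where each [f k] is [X], or at far ends, where each [f k] agrees with [c]. *)
pose c' v := if [pick p | onarm v p] is Some p then f (tag p) (tagged p) else c v.
have c'E k i : i <= len k -> c' (arm S k i) = f k i.
  move=> li; rewrite /c'; case: pickP => [[l j] /eqP /= E|no].
    have lj : j <= len l by rewrite -ltnS.
    move: (nat_of_ord j) lj E => {}j lj E.
    case: (arm_eq lj li E) => [[-> ->]|[-> ->]|[_ ej ei]] //.
      by rewrite !f0.
    by rewrite ei ej !fe -ej -ei E.
  have := no (Tagged (fun k => 'I_(len k).+1) (inord i : 'I_(len k).+1)).
  by rewrite /onarm /= inordK // eqxx.
have c'0 v : v \notin S_vertices S :\: S_fixed S -> c' v = c v.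
  rewrite inE negb_and negbK => /orP[/mem_S_fixed[k ->]|nv].
    by rewrite c'E.
  rewrite /c'; case: pickP => // -[k i] /eqP E; case/mem_S_vertices: nv.
  by exists k, i; rewrite // -ltnS.
have out v : v \notin S_vertices S :\: S_fixed S -> v \notin interior (arm1 S).
  apply: contra => /arm_interior1[i li ->]; rewrite inE; apply/andP; split.
    apply/negP => /mem_S_fixed[k].
    have li' : i <= len None by rewrite /=; lia.
    by case/(arm_eq (k := None) li' (leqnn _)) => [[<- /=]|[]|[_ /=]]; lia.
  by apply/mem_S_vertices; exists None, i => //=; lia.
have inS v : v \in S_vertices S :\: S_fixed S -> exists k, exists2 i, i < len k & v = arm S k i.
  rewrite inE => /andP[nf /mem_S_vertices[k [i li E]]]; exists k, i => //.
  rewrite ltn_neqAle li andbT; apply: contraNneq nf => ei.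
  by rewrite E ei arm_end_fixed.
have dS u v : u \in S_vertices S :\: S_fixed S -> adj u v -> [disjoint c' u & c' v].
  case/inS => k [[|i] li ->].
    rewrite arm_start => /arm_start_adj[l ->]; rewrite -(arm_start l).
    by rewrite !c'E ?arm_length_gt0 //; apply: df; apply: arm_length_gt0.
  case/(arm_interior_adj (k := k) (i := i.+1) li) => ->.
    by rewrite !c'E 1?disjoint_sym ?df //=; lia.
  by rewrite !c'E ?df //; lia.
exists c' => //; split=> [v _|u v _ _ uv].
  case: (boolP (v \in S_vertices S :\: S_fixed S)) => [/inS[k [i li ->]]|nv].
    by rewrite c'E ?cf // ltnW.
  by rewrite c'0 // cc // inE out.
case: (boolP (u \in S_vertices S :\: S_fixed S)) => [uS|nu]; first exact: dS.
case: (boolP (v \in S_vertices S :\: S_fixed S)) => [vS|nv].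
  by rewrite disjoint_sym; apply: dS; rewrite // adj_sym.
rewrite !c'0 //; apply: dc; rewrite ?inE ?out //.
rewrite /adj_off_path uv; apply/negP => /existsP[x /existsP[y /and3P[cxy /eqP ex /eqP ey]]].
(* Only the far end of the central path keeps its color there, so no edge of that path joins two
   vertices with kept colors. *)
have last_only (z : 'I_n1.+1) : arm1 S z \notin S_vertices S :\: S_fixed S -> z = n1 :> nat.
  have lz : z <= n1 by rewrite -ltnS.
  rewrite inE negb_and negbK => /orP[/mem_S_fixed[k E]|/mem_S_vertices[]]; last first.
    by exists None, z; rewrite //= inord_val.
  have E' : arm S None z = arm S k (len k) by rewrite /= inord_val.
  have := arm_length_gt0 k.
  by case: (arm_eq (k := None) lz (leqnn _) E') => [[<-]|[_ ->]|[_]].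
move: nu nv; rewrite -ex -ey => /last_only x1 /last_only y1.
by move: cxy; rewrite /consecutive; lia.
Qed.

(** Reduces the graph problem to one on sets: [A] and [B] color the ports, [C] the far end of the
    central path, and [X0] and [X] are the old and new sets of the center. *)
Lemma reducible_of_compat b e :
  (forall A B C X0 : {set 'I_(2 * b + e)},
     #|A| = b -> #|B| = b -> #|C| = b -> #|X0| = b ->
     compat e n2 X0 A -> compat e n3 X0 B ->
     exists X : {set 'I_(2 * b + e)},
       [/\ #|X| = b, compat e n1 X C, compat e n2 X A & compat e n3 X B]) ->
  reducible (2 * b + e) b S.
Proof.
move=> H c cc.
have cI : #|'I_(2 * b + e)| = 2 * b + e by rewrite card_ord.
have [c2 d2] := @arm_chain_off _ _ c (Some true) cc isT.
have [c3 d3] := @arm_chain_off _ _ c (Some false) cc isT.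
have k2 : compat e n2 (c (arm1 S ord0)) (c (arm S (Some true) n2)).
  rewrite -(arm_start (Some true)).
  exact: (compat_chain (f := fun i => c (arm S (Some true) i)) cI c2 d2).
have k3 : compat e n3 (c (arm1 S ord0)) (c (arm S (Some false) n3)).
  rewrite -(arm_start (Some false)).
  exact: (compat_chain (f := fun i => c (arm S (Some false) i)) cI c3 d3).
have e1 : #|c (arm S None n1)| = b.
  apply: cc.1; rewrite inE; apply/arm_interior1 => -[i li].
  have li' : i <= len None by rewrite /=; lia.
  by case/(arm_eq (k := None) (leqnn _) li') => [[_]|[]|[]] //=; have := arm_length_gt0 None; lia.
have e2 := c2 _ (leqnn _); have e3 := c3 _ (leqnn _).
have e0 := c2 _ (leq0n _).
rewrite arm_start in e0.
have [X [cX h1 h2 h3]] := H _ _ _ _ e2 e3 e1 e0 k2 k3.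
have [f1 [f10 f1n cf1 df1]] := compat_path cI cX e1 h1.
have [f2 [f20 f2n cf2 df2]] := compat_path cI cX e2 h2.
have [f3 [f30 f3n cf3 df3]] := compat_path cI cX e3 h3.
apply: (recolor_arms (X := X)
  (f := fun k => match k with None => f1 | Some true => f2 | Some false => f3 end)) => //;
  by case=> [[]|].
Qed.

End ArmFacts.

(** * Spiders as counterexamples to reducibility *)

Ltac ifs_lia :=
  repeat match goal with |- context [if ?c then _ else _] => destruct c eqn:? end; lia.

(* The spider with center 0 and three legs of lengths [m1], [m2], [m3], whose
   vertices are numbered outwards from 0, leg after leg. *)
Definition spider_parent (m1 m2 v : nat) : nat :=
  if (v == m1.+1) || (v == (m1 + m2).+1) then 0 else v.-1.

Definition spider_rel (m1 m2 u v : nat) : bool :=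
  (0 < v) && (u == spider_parent m1 m2 v) || (0 < u) && (v == spider_parent m1 m2 u).

Definition spider_adj (m1 m2 m3 : nat) : rel 'I_(m1 + m2 + m3).+1 :=
  fun u v => spider_rel m1 m2 u v.

Lemma spider_adj_sym m1 m2 m3 : symmetric (@spider_adj m1 m2 m3).
Proof. by move=> u v; rewrite /spider_adj /spider_rel orbC. Qed.

Lemma spider_adj_irrefl m1 m2 m3 : irreflexive (@spider_adj m1 m2 m3).
Proof. by move=> u; rewrite /spider_adj /spider_rel /spider_parent; ifs_lia. Qed.

Definition spider (m1 m2 m3 : nat) : sgraph :=
  SGraph (@spider_adj_sym m1 m2 m3) (@spider_adj_irrefl m1 m2 m3).

Lemma spider_eqE m1 m2 m3 (u v : spider m1 m2 m3) :
  (u == v) = (nat_of_ord u == nat_of_ord v).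
Proof. by []. Qed.

(** All legs share the vertex 0, so position 0 is not shifted by the offset of the leg. *)
Definition spider_index (off i : nat) : nat := if i == 0 then 0 else off + i.

Definition spider_leg (m1 m2 m3 off n : nat) : 'I_n.+1 -> spider m1 m2 m3 :=
  fun i => inord (spider_index off i).

Definition is_leg (m1 m2 m3 off n : nat) : Prop :=
  [\/ off = 0 /\ n = m1, off = m1 /\ n = m2 | off = m1 + m2 /\ n = m3].

Lemma spider_legK m1 m2 m3 off n (i : 'I_n.+1) : is_leg m1 m2 m3 off n ->
  nat_of_ord (spider_leg m1 m2 m3 off i) = spider_index off i.
Proof.
move=> leg; rewrite inordK // /spider_index; have := ltn_ord i.
by case: eqP => // _; case: leg => -[? ?]; lia.
Qed.

Lemma spider_leg_handle m1 m2 m3 off n : 0 < n -> 0 < m1 -> 0 < m2 -> is_leg m1 m2 m3 off n ->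
  handle (@spider_leg m1 m2 m3 off n).
Proof.
move=> n0 m10 m20 leg; split=> //.
- move=> i j /(congr1 (@nat_of_ord _)); rewrite !spider_legK // => E.
  by apply: val_inj => /=; move: E; rewrite /spider_index; ifs_lia.
- move=> i j; rewrite /= /spider_adj /consecutive !spider_legK //.
  have := ltn_ord i; have := ltn_ord j; rewrite /spider_rel /spider_parent /spider_index.
  by case: leg => -[? ?]; ifs_lia.
- move=> v /imsetP[i]; rewrite inE => lt_i ->.
  pose x : spider m1 m2 m3 := spider_leg m1 m2 m3 off (inord i.-1 : 'I_n.+1).
  pose y : spider m1 m2 m3 := spider_leg m1 m2 m3 off (inord i.+1 : 'I_n.+1).
  have xE : x = spider_index off i.-1 :> nat by rewrite spider_legK // inordK //; lia.
  have yE : y = spider_index off i.+1 :> nat by rewrite spider_legK // inordK //; lia.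
  have xy : x != y by rewrite spider_eqE /= xE yE /spider_index; ifs_lia.
  rewrite /degree; have -> : [set w | adj (spider_leg m1 m2 m3 off i) w] = [set x; y].
    apply/setP => w; rewrite !inE !spider_eqE /= /spider_adj spider_legK // xE yE.
    have := ltn_ord w; rewrite /spider_rel /spider_parent /spider_index.
    by case: leg => -[? ?]; ifs_lia.
  by rewrite cards2 xy.
Qed.

Lemma is_leg1 m1 m2 m3 : is_leg m1 m2 m3 0 m1. Proof. by constructor 1. Qed.
Lemma is_leg2 m1 m2 m3 : is_leg m1 m2 m3 m1 m2. Proof. by constructor 2. Qed.
Lemma is_leg3 m1 m2 m3 : is_leg m1 m2 m3 (m1 + m2) m3. Proof. by constructor 3. Qed.

Lemma spider_legs_disjoint m1 m2 m3 off n off' n' :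
  is_leg m1 m2 m3 off n -> is_leg m1 m2 m3 off' n' -> off + n <= off' ->
  0 < n -> 0 < n' ->
  internally_disjoint (@spider_leg m1 m2 m3 off n) (@spider_leg m1 m2 m3 off' n').
Proof.
move=> leg leg' off_lt n0 n0'; split=> [|i j] /(congr1 (@nat_of_ord _)).
  by rewrite !spider_legK // !inordK ?ltnS // /spider_index /=; lia.
rewrite !spider_legK // => E; left; have := ltn_ord i; rewrite /spider_index in E *.
by split; apply: val_inj => /=; move: E; ifs_lia.
Qed.

Lemma spider_leg0 m1 m2 m3 off n : spider_leg m1 m2 m3 off (@ord0 n) = ord0.
Proof. exact: inord0. Qed.

Lemma spider_center_degree m1 m2 m3 : 0 < m1 -> 0 < m2 -> 0 < m3 ->
  degree (ord0 : spider m1 m2 m3) = 3.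
Proof.
move=> m10 m20 m30.
pose x : spider m1 m2 m3 := inord 1.
pose y : spider m1 m2 m3 := inord m1.+1.
pose z : spider m1 m2 m3 := inord (m1 + m2).+1.
have xE : x = 1 :> nat by rewrite inordK //; lia.
have yE : y = m1.+1 :> nat by rewrite inordK //; lia.
have zE : z = (m1 + m2).+1 :> nat by rewrite inordK //; lia.
rewrite /degree; have -> : [set w | adj (ord0 : spider m1 m2 m3) w] = x |: [set y; z].
  apply/setP => w; rewrite !inE !spider_eqE /= /spider_adj xE yE zE.
  by have := ltn_ord w; rewrite /spider_rel /spider_parent /=; ifs_lia.
by rewrite cardsU1 cards2 !inE !spider_eqE /= xE yE zE; lia.
Qed.

Lemma spider_S_handle m1 m2 m3 : 0 < m1 -> 0 < m2 -> 0 < m3 ->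
  exists S : S_handle (spider m1 m2 m3) m1 m2 m3,
    [/\ arm1 S = @spider_leg m1 m2 m3 0 m1, arm2 S = @spider_leg m1 m2 m3 m1 m2 &
        arm3 S = @spider_leg m1 m2 m3 (m1 + m2) m3].
Proof.
move=> m10 m20 m30.
have l1 := is_leg1 m1 m2 m3; have l2 := is_leg2 m1 m2 m3; have l3 := is_leg3 m1 m2 m3.
unshelve eexists (@SHandle (spider m1 m2 m3) m1 m2 m3 (@spider_leg _ _ _ 0 m1)
  (@spider_leg _ _ _ m1 m2) (@spider_leg _ _ _ (m1 + m2) m3) _ _ _ _ _ _ _ _ _).
- exact: spider_leg_handle.
- exact: spider_leg_handle.
- exact: spider_leg_handle.
- by rewrite !spider_leg0.
- by rewrite !spider_leg0.
- by rewrite spider_leg0 spider_center_degree.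
- by apply: spider_legs_disjoint; rewrite // add0n.
- by apply: spider_legs_disjoint; rewrite // add0n leq_addr.
- exact: spider_legs_disjoint.
- by split.
Qed.

(** The numbers strictly between 0 and [m1] form the interior of the central path, so [col] is
    constrained only at 0, at [m1] and beyond. The last premise excludes every recoloring of the
    three legs that keeps their ends. *)
Lemma not_reducible_spider a b m1 m2 m3 (col : nat -> {set 'I_a}) :
  0 < m1 -> 0 < m2 -> 0 < m3 -> #|col 0| = b -> #|col m1| = b ->
  (forall v, m1 < v <= m1 + m2 + m3 ->
     #|col v| = b /\ [disjoint col (spider_parent m1 m2 v) & col v]) ->
  (forall f : option bool -> nat -> {set 'I_a},
    f None m1 = col m1 -> f (Some true) m2 = col (m1 + m2) ->
    f (Some false) m3 = col (m1 + m2 + m3) ->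
    (forall k l, f k 0 = f l 0) ->
    (forall k i, i <= arm_length m1 m2 m3 k -> #|f k i| = b) ->
    (forall k i, i < arm_length m1 m2 m3 k -> [disjoint f k i & f k i.+1]) -> False) ->
  ~ reducible_type a b m1 m2 m3.
Proof.
move=> m10 m20 m30 col0 colm colv noext red.
have [S [S1 S2 S3]] := spider_S_handle m10 m20 m30.
have [c' [cc' dc'] c'E] : exists2 c' : spider m1 m2 m3 -> {set 'I_a}, coloring b c' &
    forall v, v \notin S_vertices S :\: S_fixed S -> c' v = col v.
  apply: (red _ S (fun v => col v)).
  have ext (v : spider m1 m2 m3) : v \notin interior (arm1 S) ->
      [\/ v = 0 :> nat, v = m1 :> nat | m1 < v <= m1 + m2 + m3].
    move=> nv; have [v0|v0] := posnP v; first by constructor 1.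
    have [v1|v1|v1] := ltngtP v m1; [|by constructor 3; rewrite /= -ltnS ltn_ord|by constructor 2].
    case/negP: nv; apply/imsetP; exists (inord v).
      by rewrite inE inordK; lia.
    apply: ord_inj; rewrite S1 spider_legK; last exact: is_leg1.
    by rewrite /spider_index inordK /=; ifs_lia.
  split=> [v|u v]; rewrite inE.
    by move/ext=> [->|->|/colv[]].
  rewrite inE => /ext ue /ext ve; rewrite /adj_off_path => /andP[uv /negP npath].
  (* The excluded case is the single edge of a central path of length 1, which [adj_off_path]
     removes. *)
  have dis (x y : nat) : [\/ x = 0, x = m1 | m1 < x <= m1 + m2 + m3] ->
      [\/ y = 0, y = m1 | m1 < y <= m1 + m2 + m3] ->
      0 < y -> x = spider_parent m1 m2 y -> ~ (x = 0 /\ y = m1 /\ m1 = 1) ->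
      [disjoint col x & col y].
    move=> xe [y1|y1|/colv[_ dy]] y0 E ne; [lia| |by rewrite E].
    by exfalso; move: E; rewrite /spider_parent; case: xe; ifs_lia.
  have S1v (i : nat) : i <= m1 -> nat_of_ord (arm1 S (inord i)) = i.
    move=> li; rewrite S1 spider_legK ?/spider_index ?inordK //; last exact: is_leg1.
    by case: eqP.
  case/orP: uv => /andP[p0 /eqP E]; last rewrite disjoint_sym; apply: dis => //.
    move=> [u0 [v1 m1E]]; apply: npath; apply/existsP; exists (inord 0).
    apply/existsP; exists (inord 1); rewrite /consecutive !inordK ?ltnS ?m1E //=.
    by rewrite !spider_eqE /= !S1v; lia.
  move=> [v0 [u1 m1E]]; apply: npath; apply/existsP; exists (inord 1).
  apply/existsP; exists (inord 0); rewrite /consecutive !inordK ?ltnS ?m1E //=.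
  by rewrite !spider_eqE /= !S1v; lia.
have fixE k : c' (arm S k (arm_length m1 m2 m3 k)) = col (arm S k (arm_length m1 m2 m3 k)).
  by apply: c'E; rewrite inE arm_end_fixed.
have endE off n : is_leg m1 m2 m3 off n -> 0 < n ->
    nat_of_ord (spider_leg m1 m2 m3 off (inord n : 'I_n.+1)) = off + n.
  by move=> leg n0; rewrite spider_legK // inordK // /spider_index; case: eqP; lia.
apply: (noext (fun k i => c' (arm S k i))).
- by rewrite (fixE None) /= S1 endE //; apply: is_leg1.
- by rewrite (fixE (Some true)) /= S2 endE //; apply: is_leg2.
- by rewrite (fixE (Some false)) /= S3 endE //; apply: is_leg3.
- by move=> k l; rewrite !arm_start.
- by move=> k i _; apply: cc'.
- by move=> k i li; apply: dc' => //; apply: arm_adj.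
Qed.

(* The ends of the path formed by the first and third arms get colors of an
   alternating coloring with the wrong parity. *)
Lemma not_reducible_short b e p m1 m2 m3 :
  0 < m1 -> 0 < m2 -> 0 < m3 -> (p - 1) * e < b -> m1 + m3 < 2 * p ->
  ~ reducible_type (2 * b + e) b m1 m2 m3.
Proof.
move=> m10 m20 m30 ltb ltp.
have cI : #|'I_(2 * b + e)| = 2 * b + e by rewrite card_ord.
have [|X [_ _ cX]] := @subset_sandwich _ set0 [set: 'I_(2 * b + e)] b (sub0set _).
  by rewrite cards0 cardsT cI; lia.
have [|Y [_ sY cY]] := @subset_sandwich _ set0 (~: X) b (sub0set _).
  by rewrite cards0 (card_setC_coloring cI cX) leq_addr.
have dYX : [disjoint Y & X] by rewrite disjoints_subset.
pose alt (o : bool) := if o then Y else X.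
have calt o : #|alt o| = b by case: o.
have dalt o o' : o != o' -> [disjoint alt o & alt o'].
  by case: o; case: o' => //= _; rewrite disjoint_sym.
(* The second and third legs alternate outwards from [X] at the center; the end of the first leg
   gets the set of the wrong parity. For [v < m1] the truncated difference is 0, which gives [X] at
   the center. *)
pose col v := if v == m1 then alt (~~ odd m1) else
  alt (odd (v - (if v <= m1 + m2 then m1 else m1 + m2))).
have colm : col m1 = alt (~~ odd m1) by rewrite /col eqxx.
have colE v : v != m1 -> col v = alt (odd (v - (if v <= m1 + m2 then m1 else m1 + m2))).
  by rewrite /col => /negbTE->.
apply: (@not_reducible_spider _ _ _ _ _ col) => //.
- by rewrite colE ?calt //; lia.
- by rewrite colm.
- move=> v lt_v; rewrite colE; last by lia.
  split=> //; rewrite colE /spider_parent; last by ifs_lia.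
  by apply: dalt; ifs_lia.
move=> f f1 _ f3 f0 cf df.
(* The path from the end of the third leg through the center to the end of the first. *)
pose g i := if i <= m3 then f (Some false) (m3 - i) else f None (i - m3).
have cg i : i <= m1 + m3 -> #|g i| = b.
  by rewrite /g => li; case: leqP => h; apply: cf => /=; lia.
have dg i : i < m1 + m3 -> [disjoint g i & g i.+1].
  rewrite /g => li; have [h|h|->] := ltngtP i m3.
  - rewrite disjoint_sym; have -> : m3 - i = (m3 - i.+1).+1 by lia.
    by apply: df => /=; lia.
  - by rewrite subSn ?(ltnW h) //; apply: df => /=; lia.
  - by rewrite subnn subSnn (f0 _ None); apply: df.
have := compat_chain cI cg dg; rewrite /g leq0n subn0 f3.
have -> : m1 + m3 <= m3 = false by lia.
rewrite addnK f1 colm colE; last by lia.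
have -> : (m1 + m2 + m3 <= m1 + m2) = false by lia.
(* The ends of this path have equal sets if its length is odd and disjoint sets if it is even;
   either way [compat] would require [b <= (m1 + m3)./2 * e]. *)
rewrite addKn /compat; have lt_half : (m1 + m3)./2 <= p - 1 by lia.
have lt_b := leq_ltn_trans (leq_mul lt_half (leqnn e)) ltb.
have nb : (b <= (m1 + m3)./2 * e) = false by rewrite leqNgt lt_b.
have eYX : Y :\: X = Y by apply/setDidPl.
have eXY : X :\: Y = X by apply/setDidPl; rewrite disjoint_sym.
by rewrite oddD; case: (odd m1); case: (odd m3); rewrite /= ?setIid ?eYX ?eXY ?cX ?cY nb.
Qed.

(** The ports get sets [A] and [B] that together cover the complement of [X], which forces [X] at
    the center. The far end of the central path also gets [X], and a path of odd length [m1] joins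
    [X] to itself only if [b <= m1./2 * e]. *)
Lemma not_reducible_11 b e m1 : e <= b -> odd m1 -> m1./2 * e < b ->
  ~ reducible_type (2 * b + e) b m1 1 1.
Proof.
move=> leb oddm ltb; have m10 : 0 < m1 by case: m1 oddm {ltb}.
have cI : #|'I_(2 * b + e)| = 2 * b + e by rewrite card_ord.
have [|X [_ _ cX]] := @subset_sandwich _ set0 [set: 'I_(2 * b + e)] b (sub0set _).
  by rewrite cards0 cardsT cI; lia.
have cCX := card_setC_coloring cI cX.
have [|A [_ sA cA]] := @subset_sandwich _ set0 (~: X) b (sub0set _).
  by rewrite cards0 cCX leq_addr.
have [|B [sB1 sB2 cB]] := @subset_sandwich _ (~: X :\: A) (~: X) b (subsetDl _ _).
  by rewrite cardsD (setIidPr sA) cCX cA; lia.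
have dXA : [disjoint X & A] by rewrite disjoint_sym disjoints_subset.
have dXB : [disjoint X & B] by rewrite disjoint_sym disjoints_subset.
pose col v := if v <= m1 then X else if v == m1.+1 then A else B.
have colX v : v <= m1 -> col v = X by rewrite /col => ->.
have colA : col (m1 + 1) = A by rewrite /col addn1 ltnn eqxx.
have colB : col (m1 + 1 + 1) = B.
  by rewrite /col !addn1 ltnNge leqnSn /= eqn_leq ltnn.
apply: (@not_reducible_spider _ _ _ _ _ col) => //.
- by rewrite colX.
- move=> v lt_v; have [->|->] : v = m1 + 1 \/ v = m1 + 1 + 1 by lia.
    by rewrite colA /spider_parent addn1 eqxx colX.
  by rewrite colB /spider_parent !addn1 eqxx orbT colX.
move=> f; rewrite colX // colA colB => f1 f2 f3 f0 cf df.
have fX : f None 0 = X.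
  apply/eqP; rewrite eqEcard cX cf // leqnn andbT.
  apply/subsetP => x fx; apply: contraT => nX.
  have := df (Some true) 0 isT; rewrite f2 (f0 _ None) => /disjointFr/(_ fx) xA.
  have := df (Some false) 0 isT; rewrite f3 (f0 _ None) => /disjointFr/(_ fx).
  by rewrite (subsetP sB1) // !inE xA.
have := compat_chain cI (cf None) (df None).
by rewrite fX /= f1 /compat oddm setIid cX leqNgt ltb.
Qed.

(** * The two reducible families and their minimality *)

Lemma EvenP b e : 0 < b -> 0 < e ->
  exists p, [/\ Even ((2 * b)%:R / e%:R)%R = 2 * p, b <= p * e & (p - 1) * e < b].
Proof.
move=> b0 e0; rewrite /Even; case: ex_minnP => n.
have geE m : (((2 * b)%:R / e%:R : rat) <= m%:R)%R = (2 * b <= m * e).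
  by rewrite ler_pdivrMr ?ltr0n // -natrM ler_nat.
(* The witness is the ceiling of [b / e]; minimality is tested on the preceding even number. *)
rewrite geE => /andP[evn len] minE; exists n./2.
have n2 : n = 2 * n./2 by rewrite mul2n -[LHS](odd_double_half n) (negbTE evn).
split=> //; first by rewrite n2 -mulnA leq_pmul2l in len.
rewrite ltnNge; apply/negP => leb.
have [n0|n0] := posnP n./2; first by rewrite n0 mul0n leqn0 in leb; rewrite (eqP leb) in b0.
have /minE : ~~ odd (2 * (n./2 - 1)) && ((2 * b)%:R / e%:R <= (2 * (n./2 - 1))%:R :> rat)%R.
  by rewrite geE -mulnA leq_pmul2l // leb andbT oddM.
by lia.
Qed.

(** The arms of lengths 2 and 1 ask for at most [e] elements outside [A] and none in [B]. The
    central path allows [(p - 1) * e] elements of [C], which is at least [b - e]. *)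
Lemma reducible_type_2_1 b e p : e <= b -> b <= p * e -> 0 < p ->
  reducible_type (2 * b + e) b (2 * p - 1) 2 1.
Proof.
move=> leb lep p0 G S; apply: reducible_of_compat => A B C X0 cA cB cC cX0.
have cI : #|'I_(2 * b + e)| = 2 * b + e by rewrite card_ord.
rewrite /compat /= mul1n mul0n leqn0 cards_eq0 => h2 h1.
have [|X [cX dX hA hC]] := @recolor_2_1 _ b e A B C X0 cI leb cB cC cX0 _ h2.
  by rewrite -setI_eq0.
exists X; split=> //; last by rewrite leqn0 cards_eq0 setI_eq0.
have -> : odd (2 * p - 1) by lia.
have -> : (2 * p - 1)./2 = p - 1 by lia.
by apply: leq_trans hC _; rewrite mulnBl mul1n leq_sub2r.
Qed.

(** For even [k] the constraints bound [X :\: A] and [X :\: B]. For odd [k] they bound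
    intersections, which are differences with the complements; these have [b + 1] elements, hence
    [s = 1]. *)
Lemma reducible_type_kk b k : 2 <= k <= b ->
  reducible_type (2 * b + 1) b (2 * b - k) k k.
Proof.
move=> /andP[k2 lekb] G S; apply: reducible_of_compat => A B C X0 cA cB cC cX0.
have cI : #|'I_(2 * b + 1)| = 2 * b + 1 by rewrite card_ord.
have k0 : 0 < k./2 by lia.
rewrite /compat !muln1; have -> : odd (2 * b - k) = odd k by lia.
have cN Z := card_setC_coloring (X := Z) cI.
case: (boolP (odd k)) => ok h2 h3.
  have [//||||X [cX hA hB hC]] :=
    @recolor_three _ b k./2 1 (~: A) (~: B) (~: C) X0 cI k0 _ _ (cN _ cA) (cN _ cB) (cN _ cC) cX0.
  - by lia.
  - by rewrite setDE setCK.
  - by rewrite setDE setCK.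
  exists X; rewrite !setDE !setCK in hA hB; split=> //.
  have -> : (2 * b - k)./2 = b - k./2 - 1 by lia.
  by have := cardsID C X; rewrite setDE; lia.
have [//|||||X [cX hA hB hC]] :=
    @recolor_three _ b k./2 0 A B C X0 cI k0 _ _ _ _ _ cX0 h2 h3; rewrite ?addn0 //.
  by lia.
exists X; split=> //.
have -> : (2 * b - k)./2 = b - k./2 by lia.
by have := cardsID C X; lia.
Qed.

(** The second claim fails for [k = 1]: by [not_reducible_11], S(2b-1,1,1) is not
    (2b+1,b)-reducible. *)
Theorem theorem3 (b e k : nat) (hb : 0 < b) (he : 0 < e) (hk : 0 < k)
    (hbek : maxn 2 (maxn e.+1 k) <= b) :
  smallest_reducible (2 * b + e) b (Even ((2 * b)%:R / e%:R)%R - 1) 2 1 /\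
  (2 <= k -> smallest_reducible (2 * b + 1) b (2 * b - k) k k).
Proof.
move: hbek; rewrite !geq_max => /and3P[b2 lt_eb le_kb].
split=> [|k2]; last first.
  split; first by rewrite /S_type; lia.
    by apply: reducible_type_kk; rewrite k2.
  move=> m1 m2 m3 /and3P[m30 le32 le21] /and4P[l1 l2 l3].
  rewrite !xpair_eqE => ne.
  (* If [m1 + m3] were [2 * b], then [m3 = k], and [m3 <= m2 <= k] would make the types equal. *)
  by apply: (@not_reducible_short b 1 b); lia.
have [p [-> lep ltp]] := EvenP hb he.
have p2 : 1 < p.
  by rewrite ltnNge; apply/negP => p1; have := leq_mul p1 (leqnn e); lia.
split; first by rewrite /S_type; lia.
  by apply: reducible_type_2_1 => //; lia.
move=> m1 m2 m3 /and3P[m30 le32 le21] /and4P[l1 l2 l3].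
rewrite !xpair_eqE => ne.
have [small|big] := ltnP (m1 + m3) (2 * p).
  by apply: (@not_reducible_short b e p) => //; lia.
(* Equality [m1 + m3 = 2 * p] fixes [m1] and [m3], and strictness then excludes [m2 = 2]. *)
have [-> -> ->] : [/\ m1 = 2 * p - 1, m2 = 1 & m3 = 1] by split; lia.
apply: not_reducible_11; [exact: ltnW | lia |].
by have -> : (2 * p - 1)./2 = p - 1 by lia.
Qed.
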